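(* For all sufficiently large $k$, with suitable $d=\Theta(\log k)$ and $R=\Theta(\log k)$, there exist two uniform mixtures of Laplace distributions on $\mathbb{R}^d$, $Y\sim\frac1k\sum_{j=1}^k\mathrm{Lap}(\mu_j,I_d)$ and $\tilde Y\sim\frac1k\sum_{j=1}^k\mathrm{Lap}(\tilde\mu_j,I_d)$, such that $$\|\mathbb{E}Y^{\otimes r}-\mathbb{E}\tilde Y^{\otimes r}\|_F\le k^{-\Omega(\log\log k)}\quad\text{for all }r=1,2,\dots,R,$$ while their parameter distance is at least $\Omega(\sqrt{\log k})$.
   Context: $\mathrm{Lap}(\mu,I_d)$ is the multivariate Laplace distribution with characteristic function $\frac{e^{i\langle t,\mu\rangle}}{1+\frac12\|t\|_2^2}$. For an order-$\ell$ tensor $T\in\mathbb{R}^{d^\ell}$, $\|T\|_F=(\sum_{i_1,\dots,i_\ell}T_{i_1,\dots,i_\ell}^2)^{1/2}$. The parameter distance between the two mixtures is $\min_{\pi\in S_k}\sum_j\|\mu_j-\tilde\mu_{\pi(j)}\|_2$ over permutations $\pi$ of $[k]$. *)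

(* Defs.v *)
From HB Require Import structures.
From mathcomp Require Import all_boot all_order all_algebra all_fingroup.
From mathcomp Require Import complex.
From mathcomp Require Import all_classical all_reals all_analysis.

Set Implicit Arguments.
Unset Strict Implicit.
Unset Printing Implicit Defensive.

Import Order.TTheory GRing.Theory Num.Theory.
Local Open Scope ring_scope.

(* R^d is the type of d-tuples with the product (i.e. Borel) sigma-algebra. *)
Definition dotv (R : realType) (d : nat) (x y : d.-tuple R) : R :=
  \sum_(i < d) tnth x i * tnth y i.

Definition norm2 (R : realType) (d : nat) (x : d.-tuple R) : R :=
  Num.sqrt (\sum_(i < d) tnth x i ^+ 2).

Definition dist2 (R : realType) (d : nat) (x y : d.-tuple R) : R :=
  norm2 [tuple tnth x i - tnth y i | i < d].

(* e^{i x} *)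
Definition expi (R : realType) (x : R) : R[i] := Complex (cos x) (sin x).

(* E e^{i <t, X>} for X ~ P; the integrands are bounded and measurable. *)
Definition char_fun (R : realType) (d : nat) (P : probability (d.-tuple R) R)
    (t : d.-tuple R) : R[i] :=
  Complex (fine ('E_P[fun x => cos (dotv t x)]))
          (fine ('E_P[fun x => sin (dotv t x)])).

Definition is_Lap (R : realType) (d : nat) (P : probability (d.-tuple R) R)
    (mu : d.-tuple R) : Prop :=
  forall t, char_fun P t =
    expi (dotv t mu) / (Complex (1 + 2^-1 * norm2 t ^+ 2) 0).

Definition is_unif_Lap_mixture (R : realType) (k d : nat)
    (P : probability (d.-tuple R) R) (mu : 'I_k -> d.-tuple R) : Prop :=
  exists L : 'I_k -> probability (d.-tuple R) R,
    (forall j, is_Lap (L j) (mu j)) /\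
    (forall A, measurable A ->
       P A = ((k%:R^-1)%:E * \sum_(j < k) L j A)%E).

(* Order-r tensors over R^d, indexed by (i_1, ..., i_r). *)
Definition tensor (R : realType) (d r : nat) : Type :=
  {ffun {ffun 'I_r -> 'I_d} -> R}.

Definition normF (R : realType) (d r : nat) (T : tensor R d r) : R :=
  Num.sqrt (\sum_i T i ^+ 2).

Definition tensor_pow (R : realType) (d r : nat) (x : d.-tuple R) :
    tensor R d r :=
  [ffun i : {ffun 'I_r -> 'I_d} => \prod_(s < r) tnth x (i s)].

Definition has_moment (R : realType) (d r : nat)
    (P : probability (d.-tuple R) R) : Prop :=
  forall i, P.-integrable setT (fun x => (tensor_pow r x i)%:E).

Definition moment (R : realType) (d r : nat)
    (P : probability (d.-tuple R) R) : tensor R d r :=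
  [ffun i => fine ('E_P[fun x => tensor_pow r x i])].

Definition match_cost (R : realType) (k d : nat)
    (mu nu : 'I_k -> d.-tuple R) (s : 'S_k) : R :=
  \sum_(j < k) dist2 (mu j) (nu (s j)).

(* The index value of the big minimum is itself the cost of the identity. *)
Definition param_dist (R : realType) (k d : nat)
    (mu nu : 'I_k -> d.-tuple R) : R :=
  \big[Num.min/match_cost mu nu 1%g]_(s : 'S_k) match_cost mu nu s.

(* Main.v *)
(** The moments up to order [D] can be matched exactly.  With [n = log2 k] rounded
    down and [d = n + 1], take as centers the vertices of the cube [{0,1}^d] with
    an even (resp. odd) number of ones, padded with [k - 2^n] copies of the origin.
    A monomial of degree [r <= n < d] misses a coordinate; flipping that coordinate
    exchanges the two parity classes and leaves the monomial, evaluated at any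
    common translate of the vertices, unchanged.  Hence the two mixtures give it
    the same integral, whereas every nonzero even vertex lies at distance at least 1
    from all centers of the other mixture, so the parameter distance is at least
    [2^n - 1].

    [Lap(0, I_d)] is realized as [sqrt W * G], [W] exponential and [G] standard
    Gaussian.  All characteristic functions are handled through the single family
    of integrals of [cos (<t,x> + a)]: the phase [a = 0] gives the real part and
    [a = - pi/2] the imaginary part, and the family is stable under products. *)

Require Import Defs.
From HB Require Import structures.
From mathcomp Require Import all_boot all_order all_algebra all_fingroup.
From mathcomp Require Import complex.
From mathcomp Require Import all_classical all_reals all_analysis.
From mathcomp Require Import ring lra measurable_realfun.

Set Implicit Arguments.
Unset Strict Implicit.
Unset Printing Implicit Defensive.

Import Order.TTheory GRing.Theory Num.Theory.
Import numFieldNormedType.Exports.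
Local Open Scope classical_set_scope.
Local Open Scope ring_scope.

(** * Densities and integrals over the line *)

Section density.
Local Open Scope ereal_scope.
Context d (T : measurableType d) (R : realType).
Variables (mu : {sigma_finite_measure set T -> \bar R}).
Variables (nu : {finite_measure set T -> \bar R}) (p : T -> R).
Hypothesis mp : measurable_fun setT p.
Hypothesis nuE : forall A, measurable A -> nu A = \int[mu]_(x in A) (p x)%:E.

(** The formula makes [nu] vanish on [mu]-null sets. Having equal integrals over measurable sets,
    [p] and the Radon-Nikodym derivative agree almost everywhere, so the change of variables for the
    latter carries over. *)
Lemma ge0_integral_density (f : T -> \bar R) :
  measurable_fun setT f -> (forall x, 0 <= f x) ->
  \int[nu]_x f x = \int[mu]_x (f x * (p x)%:E).
Proof.
move=> mf f0.
have mpE : measurable_fun setT (EFin \o p) by exact/measurable_EFinP.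
have numu : nu `<< mu.
  apply/null_content_dominatesP => A mA muA0; rewrite nuE//.
  by apply: null_set_integral => //; exact: measurable_funTS.
rewrite -(Radon_Nikodym_SigmaFinite.change_of_variables numu)//.
have ig := Radon_Nikodym_SigmaFinite.f_integrable numu.
apply: ae_eq_integral => //.
- by apply: emeasurable_funM => //; exact: measurable_int ig.
- exact: emeasurable_funM.
- apply: ae_eqe_mul2l; apply: integral_ae_eq => // E _ mE.
  by rewrite -Radon_Nikodym_SigmaFinite.f_integral// nuE.
Qed.

Lemma integral_density (f : T -> \bar R) : (forall x, 0 <= p x)%R ->
  nu.-integrable setT f ->
  \int[nu]_x f x = \int[mu]_x (f x * (p x)%:E).
Proof.
move=> p0 fi; have mf := measurable_int _ fi.
rewrite [LHS]integralE [RHS]integralE.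
rewrite !ge0_integral_density; [|exact: measurable_funeneg|by []
  |exact: measurable_funepos|by []].
congr (_ - _); apply: eq_integral => x _.
- by rewrite [RHS]funeposE [in LHS]funeposE maxe_pMl// ?lee_fin// mul0e.
- rewrite [RHS]funenegE [in LHS]funenegE maxe_pMl// ?lee_fin// mul0e.
  by rewrite mulNe.
Qed.

End density.

Section whole_line.
Context {R : realType}.
Notation mu := (@lebesgue_measure R).

(** Dominated convergence along growing intervals, on which the fundamental theorem of calculus
    gives a difference of values of [F] that tends to 0. *)
Lemma integral_derivative_eq0 (F f : R -> R) :
  continuous f -> (forall x : R, is_derive x 1 F (f x)) ->
  mu.-integrable setT (EFin \o f) ->
  F n%:R @[n --> \oo] --> 0 -> F (- n%:R) @[n --> \oo] --> 0 ->
  (\int[mu]_x (f x)%:E = 0)%E.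
Proof.
move=> cf dF fi Fy FNy.
have cF : continuous F.
  by move=> x; apply/differentiable_continuous/derivable1_diffP; have [] := dF x.
(* [n.+1] keeps the interval nondegenerate already at [n = 0]. *)
pose I (n : nat) := `[- n.+1%:R, n.+1%:R]%classic : set R.
pose f_ n x := ((f \_ (I n)) x)%:E.
have mf : measurable_fun setT (EFin \o f) by exact: measurable_int fi.
have [] := @dominated_convergence _ _ _ mu setT measurableT f_ (EFin \o f)
  (abse \o (EFin \o f)).
- move=> n; apply/measurable_EFinP; apply/measurable_restrict => //=.
    exact: measurable_itv.
  rewrite setTI; apply: measurable_funTS; exact/measurable_EFinP.
- by [].
- apply: aeW => x _ /=; apply: cvg_near_cst.
  exists (Num.bound `|x|) => // n /= xn; rewrite /f_ patchE mem_set//=.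
  rewrite /I/= in_itv/= -ler_norml; apply: ltW.
  apply: lt_le_trans (archi_boundP (normr_ge0 x)) _.
  by rewrite ler_nat leqW.
- exact: integrable_abse.
- apply: aeW => x n _ /=; rewrite /f_ patchE lee_fin.
  by case: ifPn => // _; rewrite normr0.
move=> _ _ cvgI.
have cvg0 : [sequence (\int[mu]_(x in setT) f_ n x)%E]_n @ \oo --> 0%:E.
  rewrite (_ : [sequence _]_n = (fun n : nat => (F n.+1%:R - F (- n.+1%:R))%:E)).
    apply: cvg_EFin; first exact: nearW.
    rewrite -(subr0 0); apply: cvgB.
    + by rewrite (cvg_shiftS (fun n => F n%:R)).
    + by rewrite (cvg_shiftS (fun n => F (- n%:R))).
  apply/funext => n.
  rewrite /= EFinB -(@continuous_FTC2 _ f F).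
  - by rewrite [RHS]integral_mkcond; apply: eq_integral => x _; rewrite restrict_EFin.
  - by rewrite -subr_gt0 opprK addr_gt0// ltr0n.
  - exact: continuous_subspaceT.
  - split.
    + by move=> x _; have [] := dF x.
    + exact/cvg_at_right_filter/cF.
    + exact/cvg_at_left_filter/cF.
  - by move=> x _; rewrite derive1E; have [_ ->] := dF x.
exact: (cvg_unique _ cvgI cvg0).
Qed.

End whole_line.

(** [|x| ^+ n / n!] is a term of the exponential series at [|x|], and [|x|] is [x] or [- x]. This
    reduces polynomial moments to exponential ones. *)
Lemma norm_expn_le_expR {R : realType} (x : R) n :
  `|x| ^+ n <= n`!%:R * (expR x + expR (- x)).
Proof.
have h : expR `|x| <= expR x + expR (- x).
  have [x0|x0] := leP 0 x; first by rewrite ger0_norm// lerDl expR_ge0.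
  by rewrite ltr0_norm// lerDr expR_ge0.
rewrite mulrC -ler_pdivrMr ?ltr0n ?fact_gt0//; apply: le_trans h.
case: n => [|n].
  by rewrite expr0 divr1; apply: le_trans (expR_ge1Dx _); rewrite lerDl.
by apply: le_trans (expR_ge1Dxn n (normr_ge0 x)); rewrite lerDr.
Qed.

(** * The Gaussian characteristic function *)

Section gaussian.
Context {R : realType}.
Notation mu := (@lebesgue_measure R).
Let p : R -> R := normal_pdf 0 1.

Let pE x : p x = normal_peak 1 * expR (- x ^+ 2 / 2).
Proof. by rewrite /p normal_pdfE//= /normal_fun subr0 expr1n. Qed.

Let p_ge0 x : 0 <= p x. Proof. exact: normal_pdf_ge0. Qed.

Let mp : measurable_fun setT p. Proof. exact: measurable_normal_pdf. Qed.

Let measurable_affine (t a : R) : measurable_fun setT (fun x : R => t * x + a).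
Proof. by apply: measurable_funD => //; exact: measurable_funM. Qed.

Let measurable_cos_affine (t a : R) :
  measurable_fun setT (fun x : R => cos (t * x + a)).
Proof.
apply: measurableT_comp; last exact: measurable_affine.
by apply: continuous_measurable_fun; exact: continuous_cos.
Qed.

Let measurable_sin_affine (t a : R) :
  measurable_fun setT (fun x : R => sin (t * x + a)).
Proof.
apply: measurableT_comp; last exact: measurable_affine.
by apply: continuous_measurable_fun; exact: continuous_sin.
Qed.

(** Completing the square: exponential tilting translates the Gaussian density, up to a factor. *)
Let expR_normal_pdf s x : expR (s * x) * p x = expR (s ^+ 2 / 2) * normal_pdf s 1 x.
Proof.
rewrite pE normal_pdfE//= /normal_fun expr1n.
rewrite mulrCA [RHS]mulrCA -!expRD; congr (_ * expR _).
by field.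
Qed.

Let integrable_expR_normal_pdf s :
  mu.-integrable setT (fun x => (expR (s * x) * p x)%:E).
Proof.
under eq_fun do rewrite expR_normal_pdf EFinM.
by apply: integrableZl => //; exact: integrable_normal_pdf.
Qed.

Lemma integrable_norm_expn_normal_pdf n :
  mu.-integrable setT (fun x => (`|x| ^+ n * normal_pdf 0 1 x)%:E).
Proof.
have h : mu.-integrable setT
    (fun x => (n`!%:R)%:E * ((expR (1 * x) * p x)%:E + (expR (-1 * x) * p x)%:E))%E.
  by apply: integrableZl => //; apply: integrableD => //;
    exact: integrable_expR_normal_pdf.
apply: le_integrable h => //.
  apply/measurable_EFinP; apply: measurable_funM => //.
  by apply: measurable_funX; exact: normr_measurable.
move=> x _; rewrite /= lee_fin mul1r mulN1r -mulrDl mulrA.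
rewrite ger0_norm ?mulr_ge0 ?exprn_ge0//.
apply: le_trans (ler_norm _).
by rewrite ler_wpM2r// norm_expn_le_expR.
Qed.

Let integrable_bounded_normal_pdf (g : R -> R) : measurable_fun setT g ->
  (forall x, `|g x| <= 1) -> mu.-integrable setT (fun x => (g x * p x)%:E).
Proof.
move=> mg g1; apply: le_integrable (integrable_normal_pdf 0 1) => //.
  by apply/measurable_EFinP; exact: measurable_funM.
by move=> x _ /=; rewrite lee_fin normrM ler_piMl.
Qed.

Let derive_p (x : R) : is_derive x 1 p (- x * p x).
Proof.
have -> : p = fun x => normal_peak 1 * expR (- x ^+ 2 / 2) by apply/funext => y; exact: pE.
apply: is_derive_eq.
by rewrite /GRing.scale /=; field.
Qed.

(** The sign [e] lets one statement serve both ends of the line. *)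
Let cvg_p (u : R -> R) (e : R) : `|e| = 1 -> (forall x, `|u x| <= p x) ->
  u (e * n%:R) @[n --> \oo] --> 0.
Proof.
move=> e1 up; apply: norm_cvg0.
(* [(n - 1) ^ 2 >= 0] gives [- n ^ 2 / 2 <= 1 / 2 - n], hence the factor [expR 2^-1] and geometric
   decay. *)
pose C := normal_peak 1 * expR (2^-1 : R).
apply: (@squeeze_cvgr _ _ _ _ (cst 0) (fun n : nat => C * expR (1 *- n))).
- apply: nearW => n; rewrite normr_ge0/=; apply: le_trans (up _) _.
  have e2 : e ^+ 2 = 1 by rewrite -real_normK ?num_real// e1 expr1n.
  rewrite pE exprMn e2 mul1r /C -mulrA -expRD.
  rewrite ler_wpM2l ?normal_peak_ge0// ler_expR.
  have := sqr_ge0 (n%:R - 1 : R); lra.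
- exact: cvg_cst.
- by rewrite -(mulr0 C); apply: cvgM; [exact: cvg_cst|exact: cvgn_expR].
Qed.

Let derive_cos_affine (a x y : R) :
  is_derive x 1 (fun x => cos (x * y + a)) (- (y * sin (x * y + a))).
Proof. by apply: is_derive_eq; rewrite /GRing.scale /=; ring. Qed.

Let derive_sin_p (t a x : R) :
  is_derive x 1 (fun x => sin (t * x + a) * p x)
   (t * (cos (t * x + a) * p x) - x * sin (t * x + a) * p x).
Proof.
have dp := derive_p x.
by apply: is_derive_eq; rewrite /GRing.scale /=; ring.
Qed.

Let continuous_derive_sin_p (t a : R) :
  continuous (fun x => t * (cos (t * x + a) * p x) - x * sin (t * x + a) * p x).
Proof.
move=> x; apply/differentiable_continuous/derivable1_diffP.
by have dp := derive_p x; exact: ex_derive.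
Qed.

Let xsin_integrable (t a : R) :
  mu.-integrable setT (fun x => (x * sin (t * x + a) * p x)%:E).
Proof.
apply: le_integrable (integrable_norm_expn_normal_pdf 1) => //.
  apply/measurable_EFinP; apply: measurable_funM => //.
  by apply: measurable_funM => //; exact: measurable_sin_affine.
move=> x _ /=; rewrite lee_fin expr1 !normrM normr_id.
by rewrite ler_wpM2r// ler_piMr// sin_max.
Qed.

Let phi (a t : R) := (\int[mu]_x (cos (t * x + a) * p x))%R.

Let cos_integrable (t a : R) :
  mu.-integrable setT (fun x => (cos (t * x + a) * p x)%:E).
Proof.
apply: integrable_bounded_normal_pdf; first exact: measurable_cos_affine.
by move=> x; exact: cos_max.
Qed.

(** As [p' = - x p], the function [sin (t x + a) p] has derivative
    [t cos (t x + a) p - x sin (t x + a) p], whose integral over the line is 0. *)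
Let integral_xsin (a t : R) :
  (\int[mu]_x (x * sin (t * x + a) * p x))%R = t * phi a t.
Proof.
have : (\int[mu]_x
    (t * (cos (t * x + a) * p x) - x * sin (t * x + a) * p x)%:E = 0)%E.
  apply: (@integral_derivative_eq0 _ (fun x => sin (t * x + a) * p x)).
  - exact: continuous_derive_sin_p.
  - by move=> x; exact: derive_sin_p.
  - rewrite /comp; under eq_fun do rewrite EFinB [X in (X - _)%E]EFinM.
    apply: integrableB => //.
    by apply: integrableZl => //; exact: cos_integrable.
  - under eq_fun do rewrite -[X in _ * X + _]mul1r -[X in p X]mul1r.
    apply: (cvg_p (u := fun x => sin (t * x + a) * p x)); rewrite ?normr1//.
    by move=> x; rewrite normrM (ger0_norm (p_ge0 _)) ler_piMl// sin_max.
  - under eq_fun do rewrite -[X in _ * X + _]mulN1r -[X in p X]mulN1r.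
    apply: (cvg_p (u := fun x => sin (t * x + a) * p x)); rewrite ?normrN1//.
    by move=> x; rewrite normrM (ger0_norm (p_ge0 _)) ler_piMl// sin_max.
under eq_integral do rewrite EFinB [X in (X - _)%E]EFinM.
have ci := cos_integrable t a; have si := xsin_integrable t a.
rewrite integralB//; last exact: integrableZl.
rewrite integralZl//.
move/(congr1 fine); rewrite fineB ?fineM//=.
- by rewrite /phi /Rintegral => /eqP; rewrite subr_eq0 => /eqP.
- exact: integrable_fin_num.
- by rewrite fin_numM//; exact: integrable_fin_num.
- exact: integrable_fin_num.
Qed.

(* Gaussian integration by parts (integral_xsin) closes the differential equation
   phi' = - t phi of the characteristic function. *)
Let derive_phi (a t : R) : is_derive t 1 (phi a) (- (t * phi a t)).
Proof.
pose f x y := cos (x * y + a) * p y.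
have dcos (x y : R) : is_derive x 1 (f^~ y) (- (y * sin (x * y + a) * p y)).
  rewrite /f; have := derive_cos_affine a x y => dc.
  by apply: is_derive_eq; rewrite /GRing.scale /=; ring.
have d1 x y : partial1of2 f x y = - (y * sin (x * y + a) * p y).
  by rewrite partial1of2E; have [_ ->] := dcos x y.
(* Differentiation under the integral is done locally, near [t]; [|y| p y] dominates the partial
   derivative there. *)
have It : `]t - 1, t + 1[%classic t by rewrite /= in_itv/=; lra.
have H1 : forall x, `]t - 1, t + 1[%classic x -> mu.-integrable setT (EFin \o f x).
  by move=> x _; exact: cos_integrable.
have H2 : forall x y, `]t - 1, t + 1[%classic x -> setT y -> derivable (f ^~ y) x 1.
  by move=> x y _ _; have [] := dcos x y.
have H3 : mu.-integrable setT (EFin \o (fun y => `|y| ^+ 1 * p y)).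
  exact: integrable_norm_expn_normal_pdf.
have H4 : forall x y, `]t - 1, t + 1[%classic x -> setT y ->
    `|partial1of2 f x y| <= `|y| ^+ 1 * p y.
  move=> x y _ _; rewrite d1 normrN !normrM (ger0_norm (p_ge0 _)) expr1.
  by rewrite ler_wpM2r// ler_piMr// sin_max.
have H5 y : 0 <= `|y| ^+ 1 * p y by rewrite mulr_ge0// exprn_ge0.
have dF := derivable_under_integral measurableT It H1 H2 H5 H3 H4.
have dE := differentiation_under_integral measurableT It H1 H2 H5 H3 H4.
split; first exact: dF.
rewrite -derive1E dE -integral_xsin -[RHS]mulN1r -RintegralZl//;
  last exact: xsin_integrable.
by apply: eq_Rintegral => y _; rewrite d1 mulN1r.
Qed.

(** By [derive_phi], the product of [phi a t] and [expR (t ^+ 2 / 2)] has zero derivative; at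
    [t = 0] it equals [cos a]. *)
Lemma integral_cos_normal_pdf (a t : R) :
  (\int[mu]_x (cos (t * x + a) * normal_pdf 0 1 x)%:E
   = (cos a * expR (- t ^+ 2 / 2))%:E)%E.
Proof.
have -> : (\int[mu]_x (cos (t * x + a) * normal_pdf 0 1 x)%:E = (phi a t)%:E)%E.
  by rewrite /phi /Rintegral fineK//; exact: integrable_fin_num.
congr EFin.
have phi0 : phi a 0 = cos a.
  rewrite /phi; under eq_Rintegral do rewrite mul0r add0r.
  rewrite RintegralZl//; last exact: integrable_normal_pdf.
  by rewrite /Rintegral integral_normal_pdf/= mulr1.
have : phi a t * expR (t ^+ 2 / 2) = phi a 0 * expR (0 ^+ 2 / 2).
  apply: (is_derive_0_is_cst (f := fun t => phi a t * expR (t ^+ 2 / 2))) => x.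
  have dp := derive_phi a x.
  by apply: is_derive_eq; rewrite /GRing.scale /=; field.
rewrite phi0 expr0n/= mul0r expR0 mulr1 => <-.
by rewrite -mulrA -expRD mulNr subrr expR0 mulr1.
Qed.

End gaussian.

(** * Functions with all moments *)

(** Asking for all absolute moments at once gives a class closed under sums and products, so
    integrability of monomials reduces to the coordinates. *)
Definition all_moments d (T : measurableType d) (R : realType)
    (P : probability T R) (f : T -> R) :=
  measurable_fun setT f /\
  forall n, P.-integrable setT (fun x => (`|f x| ^+ n)%:E).

Section all_moments.
Context d (T : measurableType d) (R : realType) (P : probability T R).
Implicit Types f g : T -> R.

Lemma measurable_norm_expn f n :
  measurable_fun setT f -> measurable_fun setT (fun x => (`|f x| ^+ n)%:E).
Proof.
move=> mf; apply/measurable_EFinP; apply: measurable_funX.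
exact: measurableT_comp.
Qed.

Lemma all_moments_le f g : measurable_fun setT f ->
  (forall x, `|f x| <= `|g x|) -> all_moments P g -> all_moments P f.
Proof.
move=> mf fg [mg ig]; split=> // n; apply: le_integrable (ig n) => //.
  exact: measurable_norm_expn.
by move=> x _ /=; rewrite lee_fin !normrX !normr_id lerXn2r ?nnegrE.
Qed.

Lemma all_moments_cst (c : R) : all_moments P (cst c).
Proof.
by split=> // n; exact: (finite_measure_integrable_cst P (`|c| ^+ n) measurableT).
Qed.

Lemma all_momentsD f g :
  all_moments P f -> all_moments P g -> all_moments P (f \+ g).
Proof.
move=> [mf fi] [mg gi]; have mfg := measurable_funD mf mg; split=> // n.
have h : P.-integrable setT
    (fun x => (2 ^+ n)%:E * ((`|f x| ^+ n)%:E + (`|g x| ^+ n)%:E))%E.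
  by apply: integrableZl => //; apply: integrableD.
apply: le_integrable h => //; first exact: measurable_norm_expn.
move=> x _ /=; rewrite lee_fin normrX normr_id; apply: le_trans (ler_norm _).
(* The larger of the two values, here [g x], bounds the sum by [2 * |g x|]. *)
wlog fg : f g {mf fi mg gi mfg} / `|f x| <= `|g x| => [hw|].
  have [|/ltW gf] := leP `|f x| `|g x|; first exact: hw.
  by rewrite (addrC (f x)) (addrC (`|f x| ^+ n)); exact: hw.
apply: (@le_trans _ _ ((2 * `|g x|) ^+ n)).
  rewrite lerXn2r ?nnegrE ?mulr_ge0//.
  by apply: le_trans (ler_normD _ _) _; rewrite mulr2n mulrDl !mul1r lerD2r.
by rewrite exprMn ler_wpM2l ?exprn_ge0// lerDr exprn_ge0.
Qed.

(** [2ab <= a^2 + b^2] bounds the moment of order [n] of the product by those of order [2n] of the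
    factors. *)
Lemma all_momentsM f g :
  all_moments P f -> all_moments P g -> all_moments P (f \* g).
Proof.
move=> [mf fi] [mg gi]; have mfg := measurable_funM mf mg; split=> // n.
apply: le_integrable (integrableD _ (fi (2 * n)%N) (gi (2 * n)%N)) => //.
  exact: measurable_norm_expn.
move=> x _ /=; rewrite lee_fin normrX normr_id; apply: le_trans (ler_norm _).
rewrite normrM exprMn !exprM -!exprM mulnC !exprM.
set a := `|f x| ^+ n; set b := `|g x| ^+ n.
have a0 : 0 <= a by rewrite exprn_ge0.
have b0 : 0 <= b by rewrite exprn_ge0.
by have := sqr_ge0 (a - b); nra.
Qed.

Lemma all_moments_prod (I : Type) (s : seq I) (F : I -> T -> R) :
  (forall i, all_moments P (F i)) ->
  all_moments P (fun x => \prod_(i <- s) F i x).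
Proof.
move=> FP; elim: s => [|i s IH].
  by under eq_fun do rewrite big_nil; exact: all_moments_cst.
by under eq_fun do rewrite big_cons; exact: all_momentsM.
Qed.

Lemma all_moments_integrable f :
  all_moments P f -> P.-integrable setT (fun x => (f x)%:E).
Proof.
move=> [mf /(_ 1%N)]; apply: le_integrable => //; first exact/measurable_EFinP.
by move=> x _ /=; rewrite lee_fin expr1 normr_id.
Qed.

End all_moments.

Lemma all_moments_distribution d d' (T : measurableType d)
    (T' : measurableType d') (R : realType) (P : probability T R)
    (X : {mfun T >-> T'}) (f : T' -> R) :
  measurable_fun setT f ->
  all_moments P (f \o X) -> all_moments (distribution P X) f.
Proof.
move=> mf [_ fi]; split=> // n; apply: integrable_pushforward => //.
  exact: measurable_norm_expn.
by rewrite preimage_setT; exact: fi.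
Qed.

Section all_moments_product.
Context d1 d2 (T1 : measurableType d1) (T2 : measurableType d2) (R : realType).
Variables (P1 : probability T1 R) (P2 : probability T2 R).

(** Tonelli: the integrand is constant in the second variable, whose law has mass 1. *)
Lemma all_moments_fst f : all_moments P1 f -> all_moments (P1 \x P2)%E (f \o fst).
Proof.
move=> [mf fi].
have mff : measurable_fun setT (f \o (@fst T1 T2)) by exact: measurableT_comp.
split=> // n; apply/integrable12ltyP; first exact: measurable_norm_expn.
have /integrableP[_] := fi n; apply: le_lt_trans.
by under eq_integral do rewrite /= integral_cst//= probability_setT mule1.
Qed.

Lemma all_moments_snd f : all_moments P2 f -> all_moments (P1 \x P2)%E (f \o snd).
Proof.
move=> [mf fi].
have mff : measurable_fun setT (f \o (@snd T1 T2)) by exact: measurableT_comp.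
split=> // n; apply/integrable21ltyP; first exact: measurable_norm_expn.
have /integrableP[_] := fi n; apply: le_lt_trans.
by under eq_integral do rewrite /= integral_cst//= probability_setT mule1.
Qed.

End all_moments_product.

(** * One-dimensional Gaussian and exponential laws *)

Section one_dimensional_laws.
Context {R : realType}.
Notation mu := (@lebesgue_measure R).

Lemma integrable_cos d (T : measurableType d) (P : probability T R) (g : T -> R) :
  measurable_fun setT g -> P.-integrable setT (fun x => (cos (g x))%:E).
Proof.
move=> mg; apply: le_integrable (finite_measure_integrable_cst P 1 measurableT) => //=.
  apply/measurable_EFinP; apply: measurableT_comp => //.
  by apply: continuous_measurable_fun; exact: continuous_cos.
by move=> x _; rewrite lee_fin normr1 cos_max.
Qed.

Let affine_measurable (t a : R) : measurable_fun setT (fun x : R => t * x + a).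
Proof. by apply: measurable_funD => //; exact: measurable_funM. Qed.

Lemma integral_cos_normal_prob (t a : R) :
  (\int[normal_prob 0 1]_x (cos (t * x + a))%:E =
   (cos a * expR (- t ^+ 2 / 2))%:E)%E.
Proof.
rewrite -integral_cos_normal_pdf.
rewrite (@integral_density _ _ _ mu _ (normal_pdf 0 1))//.
- exact: measurable_normal_pdf.
- exact: normal_pdf_ge0.
- by apply: integrable_cos; exact: affine_measurable.
Qed.

Lemma all_moments_normal_prob : all_moments (normal_prob (0 : R) 1) id.
Proof.
split=> // n; apply/integrableP; split; first exact: measurable_norm_expn.
rewrite (@ge0_integral_density _ _ _ mu _ (normal_pdf 0 1))//.
- have /integrableP[_] := integrable_norm_expn_normal_pdf (R := R) n.
  apply: le_lt_trans; rewrite le_eqVlt; apply/orP; left; apply/eqP.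
  apply: eq_integral => x _.
  by rewrite /= normrM (ger0_norm (normal_pdf_ge0 _ _ _)).
- exact: measurable_normal_pdf.
- by apply: measurableT_comp => //; exact: measurable_norm_expn.
Qed.

Let expo : probability (measurableTypeR R) R :=
  exponential_distribution_exponential_prob__canonical__probability_measure_Probability
    (@ltr01 R).

(** Multiplying the density of rate 1 by [expR (- w s)] gives [(1 + s)^-1] times the density of rate
    [1 + s]. The form [Num.sqrt w ^+ 2] is the one that arises from scaling a Gaussian vector by
    [Num.sqrt w]. *)
Lemma exponential_law : exists E : probability (measurableTypeR R) R,
  (forall s : R, 0 <= s -> (\int[E]_w (expR (- Num.sqrt w ^+ 2 * s))%:E
    = ((1 + s)^-1)%:E)%E) /\ all_moments E id.
Proof.
exists expo.
have msq : measurable_fun setT (@Num.sqrt R).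
  by apply: continuous_measurable_fun; exact: sqrt_continuous.
split=> [s s0|].
- have s1 : 0 < 1 + s by rewrite ltr_wpDr.
  rewrite (@ge0_integral_density _ _ _ mu _ (exponential_pdf 1))//=.
  + transitivity (\int[mu]_x
        (((1 + s)^-1)%:E * (exponential_pdf (1 + s) x)%:E))%E; last first.
      rewrite ge0_integralZl ?integral_exponential_pdf ?mule1//.
      * by apply/measurable_EFinP; exact: measurable_exponential_pdf.
      * by move=> x _; rewrite lee_fin exponential_pdf_ge0// ltW.
      * by rewrite lee_fin invr_ge0 ltW.
    apply: eq_integral => x _; rewrite -!EFinM; congr EFin.
    have [x0|x0] := ltP x 0; first by rewrite !lt0_exponential_pdf// !mulr0.
    rewrite !exponential_pdfE// sqr_sqrtr// mul1r mulKf ?gt_eqF//.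
    by rewrite -expRD; congr expR; ring.
  + exact: measurable_exponential_pdf.
  + apply/measurable_EFinP; apply: measurableT_comp => //.
    apply: measurable_funM => //; apply: measurableT_comp => //.
    exact: measurable_funX.
- split=> // n; apply/integrableP; split; first exact: measurable_norm_expn.
  rewrite (@ge0_integral_density _ _ _ mu _ (exponential_pdf 1))//=.
  (* For [x >= 0], the exponential bound at [x / 2] gives [|x| ^ n <= 2 ^ (n + 1) n! expR (x / 2)].
     Against [expR (- x)] this leaves [expR (- x / 2)], which is twice the density of rate 1/2. *)
  + pose C : R := 2 ^+ n.+2 * n`!%:R.
    have h : mu.-integrable setT (fun x => C%:E * (exponential_pdf 2^-1 x)%:E)%E.
      apply: integrableZl => //; apply: integrable_exponential_pdf; lra.
    have /integrableP[_] := h; apply: le_lt_trans.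
    apply: ge0_le_integral => //=.
    * by move=> x _; rewrite lee_fin mulr_ge0// exponential_pdf_ge0.
    * apply/measurable_EFinP; apply: measurable_funM.
        by apply: measurableT_comp => //; apply: measurable_funX;
          exact: normr_measurable.
      exact: measurable_exponential_pdf.
    * apply/measurable_EFinP; apply: measurableT_comp => //.
      by apply: measurable_funM => //; exact: measurable_exponential_pdf.
    * move=> x _; rewrite lee_fin normrX normr_id; apply: le_trans (ler_norm _).
      have [x0|x0] := ltP x 0; first by rewrite !lt0_exponential_pdf// !mulr0.
      rewrite !exponential_pdfE//.
      have := norm_expn_le_expR (x / 2) n.
      have : expR (- (x / 2)) <= expR (x / 2) by rewrite ler_expR; lra.
      rewrite normrM exprMn [`|2^-1|]ger0_norm// exprVn => h1.
      rewrite ler_pdivrMr ?exprn_gt0// => h2.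
      have h3 : `|x| ^+ n <= 2 ^+ n.+1 * n`!%:R * expR (x / 2).
        apply: le_trans h2 _.
        have := mulr_ge0 (mulr_ge0 (ler0n R n`!) (exprn_ge0 n (ler0n R 2)))
          (etrans (subr_ge0 _ _) h1).
        by rewrite exprS; lra.
      rewrite mul1r; apply: le_trans (ler_wpM2r (expR_ge0 _) h3) _.
      rewrite -[leLHS]mulrA -expRD /C exprS.
      have -> : x / 2 + -1 * x = - 2^-1 * x by field.
      by rewrite le_eqVlt; apply/orP; left; apply/eqP; rewrite !exprS; field.
  + exact: measurable_exponential_pdf.
  + apply/measurable_EFinP; apply: measurableT_comp => //.
    by apply: measurable_funX; exact: normr_measurable.
Qed.

End one_dimensional_laws.

(** * Gaussian and Laplace vectors *)

(** The image law is hidden behind three transfer rules: for integrable functions, nonnegative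
    functions and moments. *)
Lemma exists_image_law d d' (T : measurableType d) (T' : measurableType d')
    (R : realType) (P : probability T R) (X : T -> T') :
  measurable_fun setT X -> exists Q : probability T' R,
    (forall f : T' -> \bar R, measurable_fun setT f ->
      P.-integrable setT (f \o X) ->
      (\int[Q]_y f y = \int[P]_x f (X x))%E) /\
    (forall f : T' -> \bar R, measurable_fun setT f -> (forall y, 0 <= f y)%E ->
      (\int[Q]_y f y = \int[P]_x f (X x))%E) /\
    (forall f : T' -> R, measurable_fun setT f ->
      all_moments P (f \o X) -> all_moments Q f).
Proof.
move=> mX.
pose X' : {mfun T >-> T'} := HB.pack X (isMeasurableFun.Build _ _ _ _ X mX).
exists (distribution P X'); split; [|split].
- by move=> f mf fi; rewrite integral_distribution.
- by move=> f mf f0; rewrite ge0_integral_distribution.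
- by move=> f mf fP; exact: all_moments_distribution.
Qed.

Section vector_laws.
Context {R : realType}.

Lemma measurable_dotv d (t : d.-tuple R) : measurable_fun setT (dotv t).
Proof.
apply: measurable_sum => i; apply: measurable_funM => //.
exact: measurable_tnth.
Qed.

Lemma measurable_dotvD d (t : d.-tuple R) (a : R) :
  measurable_fun setT (fun x => dotv t x + a).
Proof. by apply: measurable_funD => //; exact: measurable_dotv. Qed.

Lemma measurable_cos_dotv d (t : d.-tuple R) (a : R) :
  measurable_fun setT (fun x => (cos (dotv t x + a))%:E).
Proof.
apply/measurable_EFinP; apply: measurableT_comp; last exact: measurable_dotvD.
by apply: continuous_measurable_fun; exact: continuous_cos.
Qed.

(** Induction on [d], adding an independent standard Gaussian coordinate. In Fubini's theorem the
    new coordinate enters the inner integral as part of the phase, so the induction hypothesis must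
    hold for every [a]. *)
Lemma gaussian_vector d : exists G : probability (d.-tuple R) R,
  (forall (t : d.-tuple R) a, \int[G]_x (cos (dotv t x + a))%:E =
     (cos a * expR (- (\sum_(i < d) tnth t i ^+ 2) / 2))%:E)%E /\
  (forall i, all_moments G (fun x => tnth x i)).
Proof.
elim: d => [|d [G [Gcos Gmom]]].
  exists (\d_[tuple]); split=> [t a|[]//].
  under eq_integral do rewrite /dotv big_ord0 add0r.
  by rewrite integral_cst//= diracT mule1 big_ord0 oppr0 mul0r expR0 mulr1.
pose X (z : R * d.-tuple R) : d.+1.-tuple R := [tuple of z.1 :: z.2].
have mX : measurable_fun setT X by exact: measurable_cons.
have [Q [Qint [_ Qmom]]] := exists_image_law (normal_prob 0 1 \x G)%E mX.
exists Q; split=> [t a|i].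
- have tX z : dotv t (X z) + a =
      thead t * z.1 + (dotv [tuple of behead t] z.2 + a).
    rewrite addrA /dotv big_ord_recl; congr (_ * _ + _ + _).
      by apply: eq_bigr => i _; rewrite tnth_behead tnthS; congr (tnth t _ * _);
        apply/val_inj; rewrite /= inordK// ltnS.
  have ci : (normal_prob 0 1 \x G)%E.-integrable setT
      (fun z => (cos (dotv t (X z) + a))%:E).
    apply: integrable_cos.
    by apply: (measurableT_comp (measurable_dotvD t a)).
  rewrite Qint//; last exact: measurable_cos_dotv.
  rewrite -integral12_prod_meas1//=.
  rewrite /fubini_F; under eq_integral => x _.
    under eq_integral do rewrite tX/= addrCA.
    rewrite Gcos EFinM.
    over.
  rewrite integralZr//; last first.
    by apply: integrable_cos; apply: measurable_funD => //; exact: measurable_funM.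
  rewrite integral_cos_normal_prob -EFinM -mulrA -expRD; congr (_ * expR _)%:E.
  rewrite big_ord_recl -/(thead t) -mulrDl -opprD; congr (- (_ + _) / _).
  by apply: eq_bigr => i _; rewrite tnth_behead; congr (tnth t _ ^+ 2);
    apply/val_inj; rewrite /= inordK// ltnS.
- apply: Qmom; first exact: measurable_tnth.
  case: (unliftP ord0 i) => [j|] ->.
  + rewrite (_ : _ \o X = (fun x => tnth x j) \o snd).
      exact: all_moments_snd.
    by apply/funext => z; rewrite /= tnthS.
  + rewrite (_ : _ \o X = id \o fst); last exact/funext.
    by apply: all_moments_fst; exact: all_moments_normal_prob.
Qed.

Lemma all_moments_sqrt (E : probability (measurableTypeR R) R) :
  all_moments E id -> all_moments E (@Num.sqrt R).
Proof.
move=> Emom; apply: (@all_moments_le _ _ _ E _ (fun w : measurableTypeR R => 1 + `|w|)).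
- by apply: continuous_measurable_fun; exact: sqrt_continuous.
- move=> x /=; have [x0|x0] := leP x 0; first by rewrite ler0_sqrtr// normr0.
  have x0' := ltW x0.
  rewrite (ger0_norm (sqrtr_ge0 x)) (ger0_norm x0') ger0_norm ?addr_ge0//.
  have := sqr_sqrtr x0'; have := sqrtr_ge0 x; have := sqr_ge0 (Num.sqrt x - 1); lra.
- apply: (@all_momentsD _ _ _ E (cst 1)); first exact: all_moments_cst.
  apply: all_moments_le Emom => //.
  by move=> x /=; rewrite normr_id.
Qed.

(** Given [W = w], the vector [sqrt w * G] has characteristic function [expR (- w |t|^2 / 2)];
    averaging over [W] is the Laplace transform of the exponential law at [|t|^2 / 2]. *)
Lemma exists_Lap0 d : exists L : probability (d.-tuple R) R,
  (forall (t : d.-tuple R) a, \int[L]_x (cos (dotv t x + a))%:E =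
     (cos a / (1 + 2^-1 * \sum_(i < d) tnth t i ^+ 2))%:E)%E /\
  (forall i, all_moments L (fun x => tnth x i)).
Proof.
have [G [Gcos Gmom]] := gaussian_vector d.
have [E [Eint Emom]] := @exponential_law R.
have msq : measurable_fun setT (@Num.sqrt R).
  by apply: continuous_measurable_fun; exact: sqrt_continuous.
pose X (z : R * d.-tuple R) := [tuple Num.sqrt z.1 * tnth z.2 i | i < d].
have XE i : (fun x => tnth x i) \o X =
    (@Num.sqrt R \o fst) \* ((fun x => tnth x i) \o snd).
  by apply/funext => z; rewrite /= tnth_mktuple.
have mX : measurable_fun setT X.
  apply/measurable_fun_tnthP => i; rewrite XE; apply: measurable_funM.
    exact: measurableT_comp.
  by apply: measurableT_comp => //; exact: measurable_tnth.
have [Q [Qint [_ Qmom]]] := exists_image_law (E \x G)%E mX.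
exists Q; split=> [t a|i].
(* The random scale is moved from the vector to [t], where the Gaussian formula can absorb it. *)
- have tX z : dotv t (X z) = dotv [tuple Num.sqrt z.1 * tnth t i | i < d] z.2.
    by apply: eq_bigr => i _; rewrite !tnth_mktuple mulrCA mulrA.
  have ci : (E \x G)%E.-integrable setT
      (fun z => (cos (dotv t (X z) + a))%:E).
    apply: integrable_cos.
    by apply: (measurableT_comp (measurable_dotvD t a)).
  rewrite Qint//; last exact: measurable_cos_dotv.
  rewrite -integral12_prod_meas1//=.
  rewrite /fubini_F; under eq_integral => x _.
    under eq_integral do rewrite tX/=.
    rewrite Gcos EFinM.
    under eq_bigr do rewrite tnth_mktuple exprMn.
    rewrite -mulr_sumr -mulNr -mulrA.
    over.
  set S := \sum_(i < d) _.
  have S0 : 0 <= S by apply: sumr_ge0 => i _; exact: sqr_ge0.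
  rewrite integralZl//=.
    by rewrite Eint ?divr_ge0// -EFinM [S / 2]mulrC.
  apply: le_integrable (finite_measure_integrable_cst E 1 measurableT) => //=.
    apply/measurable_EFinP; apply: measurableT_comp => //.
    apply: measurable_funM => //; apply: measurableT_comp => //.
    exact: measurable_funX.
  move=> x _; rewrite lee_fin normr1 ger0_norm ?expR_ge0// -expR0 ler_expR.
  by rewrite mulNr oppr_le0 mulr_ge0 ?sqr_ge0// divr_ge0.
- apply: Qmom; first exact: measurable_tnth.
  rewrite XE; apply: all_momentsM; last exact: all_moments_snd.
  by apply: all_moments_fst; exact: all_moments_sqrt.
Qed.

Definition shiftv d (m x : d.-tuple R) : d.-tuple R :=
  [tuple tnth x i + tnth m i | i < d].

Lemma measurable_shiftv d (m : d.-tuple R) : measurable_fun setT (shiftv m).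
Proof.
apply/measurable_fun_tnthP => i.
rewrite (_ : _ \o _ = fun x => tnth x i + tnth m i); last first.
  by apply/funext => x; rewrite /= tnth_mktuple.
by apply: measurable_funD => //; exact: measurable_tnth.
Qed.

(* All the [L m] are translates of the same [L0], so a change of center becomes a
   pointwise change of the integrand. *)
Lemma exists_Lap d : exists (L0 : probability (d.-tuple R) R)
    (L : d.-tuple R -> probability (d.-tuple R) R), forall m,
  [/\ is_Lap (L m) m,
      forall i, all_moments (L m) (fun x => tnth x i) &
      forall f : d.-tuple R -> \bar R, measurable_fun setT f ->
        (forall x, 0 <= f x)%E ->
        (\int[L m]_x f x = \int[L0]_x f (shiftv m x))%E].
Proof.
have [L0 [L0cos L0mom]] := exists_Lap0 d.
suff /choice[L LP] : forall m : d.-tuple R, exists Lm : probability (d.-tuple R) R,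
  [/\ is_Lap Lm m,
      forall i, all_moments Lm (fun x => tnth x i) &
      forall f : d.-tuple R -> \bar R, measurable_fun setT f ->
        (forall x, 0 <= f x)%E ->
        (\int[Lm]_x f x = \int[L0]_x f (shiftv m x))%E].
  by exists L0, L.
move=> m; have ms := measurable_shiftv m.
have [Q [Qint [Qge0 Qmom]]] := exists_image_law L0 ms; exists Q; split=> //.
- move=> t; rewrite /char_fun !expectation.unlock /norm2.
  have S0 : 0 <= \sum_(i < d) tnth t i ^+ 2 by apply: sumr_ge0 => i _; exact: sqr_ge0.
  rewrite sqr_sqrtr//; set S := 1 + _.
  have SS : S != 0 by rewrite gt_eqF// /S ltr_wpDr// mulr_ge0.
  have Qcos a : (\int[Q]_x (cos (dotv t x + a))%:E = (cos (dotv t m + a) / S)%:E)%E.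
    rewrite Qint.
    + rewrite -L0cos; apply: eq_integral => x _; rewrite addrA; congr (cos (_ + _))%:E.
      by rewrite /dotv -big_split; apply: eq_bigr => i _; rewrite tnth_mktuple mulrDr.
    + exact: measurable_cos_dotv.
    + by apply: integrable_cos; apply: (measurableT_comp (measurable_dotvD t a)).
  have -> : (\int[Q]_x (cos (dotv t x))%:E = (cos (dotv t m) / S)%:E)%E.
    by have := Qcos 0; rewrite addr0 => <-; under [RHS]eq_integral do rewrite addr0.
  have -> : (\int[Q]_x (sin (dotv t x))%:E = (sin (dotv t m) / S)%:E)%E.
    have := Qcos (- (pi / 2)); rewrite cosBpihalf => <-.
    by under [RHS]eq_integral do rewrite cosBpihalf.
  (* The denominator is real, so it is inverted through the embedding of the reals. *)
  have -> : (Complex S 0)^-1 = Complex S^-1 0.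
    by rewrite -[Complex S 0]/(real_complex R S) -fmorphV.
  by apply/eqP; rewrite eq_complex /= !mulr0 subr0 add0r !eqxx.
- move=> i; apply: Qmom; first exact: measurable_tnth.
  rewrite (_ : _ \o _ = (fun x => tnth x i) \+ cst (tnth m i)).
    by apply: all_momentsD => //; exact: all_moments_cst.
  by apply/funext => x; rewrite /= tnth_mktuple.
Qed.

End vector_laws.

(** * Mixtures centered at the parity classes of the cube *)

Section mixture.
Context d (T : measurableType d) (R : realType) (k : nat).
Variable L : 'I_k.+1 -> probability T R.

Lemma exists_unif_mixture : exists P : probability T R,
  (forall A, P A = ((k.+1%:R^-1)%:E * \sum_(j < k.+1) L j A)%E) /\
  (forall f : T -> \bar R, measurable_fun setT f -> (forall x, 0 <= f x)%E ->
    (\int[P]_x f x = (k.+1%:R^-1)%:E * \sum_(j < k.+1) \int[L j]_x f x)%E).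
Proof.
have k0 : 0 <= k.+1%:R^-1 :> R by [].
(* [msum] takes a family indexed by all naturals; [inord] extends [L], and only its true indices are
   summed. *)
pose M : {measure set T -> \bar R} := msum (fun n => L (inord n)) k.+1.
pose m : {measure set T -> \bar R} := mscale (NngNum k0) M.
have ME A : M A = (\sum_(j < k.+1) L j A)%E.
  by apply: eq_bigr => j _; rewrite inord_val.
have m1 : m setT = 1%E.
  transitivity ((k.+1%:R^-1)%:E * M setT)%E => //; rewrite ME.
  under eq_bigr do rewrite probability_setT.
  by rewrite sumEFin sumr_const card_ord -EFinM mulVf// pnatr_eq0.
pose P : probability T R := HB.pack (m : set T -> \bar R)
  (Measure.class m) (Measure_isProbability.Build _ _ _ m m1).
exists P; split=> [A|f mf f0]; first by rewrite -ME.
rewrite (_ : (\int[P]_x f x = \int[m]_x f x)%E)//.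
rewrite /m ge0_integral_mscale//= ge0_integral_measure_sum//.
by congr (_ * _)%E; apply: eq_bigr => j _; rewrite inord_val.
Qed.

End mixture.

Section padded_sums.
Variables (I T : Type) (idx : I) (op : Monoid.law idx).

(** Separates the listed centers from the padding, whose contribution depends only on the size of
    the list. *)
Lemma big_ord_nth_default (x0 : T) (s : seq T) (k : nat) (F : T -> I) :
  (size s <= k)%N ->
  \big[op/idx]_(j < k) F (nth x0 s j) =
  op (\big[op/idx]_(x <- s) F x) (\big[op/idx]_(size s <= j < k) F x0).
Proof.
move=> sk; rewrite -(big_mkord xpredT (fun j => F (nth x0 s j))).
rewrite (@big_cat_nat _ _ _ (size s))//= (big_nth x0); congr (op _ _).
by apply: eq_big_nat => j /andP[sj _]; rewrite nth_default.
Qed.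

End padded_sums.

(** * Even and odd subsets, and flipping a coordinate *)

Section parity_classes.
Variable d : nat.

(** A vertex of the cube is encoded as the set of its coordinates equal to 1. *)
Definition parity_class (b : bool) : {set {set 'I_d}} :=
  [set v : {set 'I_d} | odd #|v| == b].

Definition flip (c : 'I_d) (v : {set 'I_d}) : {set 'I_d} :=
  if c \in v then v :\ c else c |: v.

Lemma flipK c : involutive (flip c).
Proof.
move=> v; rewrite /flip; have [cv|cv] := boolP (c \in v).
  by rewrite finset.setD11 finset.setD1K.
by rewrite finset.setU11 finset.setU1K.
Qed.

Lemma in_flip c v i : i != c -> (i \in flip c v) = (i \in v).
Proof. by move=> ic; rewrite /flip; case: ifP; rewrite !inE ?(negPf ic). Qed.

Lemma odd_flip c v : odd #|flip c v| = ~~ odd #|v|.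
Proof.
rewrite /flip; have [cv|cv] := boolP (c \in v).
  by rewrite (cardsD1 c v) cv /= negbK.
by rewrite cardsU1 cv.
Qed.

(** Reindexing by [flip c], an involution that exchanges the two classes. *)
Lemma big_parity_class (I : Type) (idx : I) (op : Monoid.com_law idx)
    (F : {set 'I_d} -> I) c : (forall v, F (flip c v) = F v) ->
  \big[op/idx]_(v in parity_class false) F v =
  \big[op/idx]_(v in parity_class true) F v.
Proof.
move=> Fc; rewrite (reindex_inj (inv_inj (flipK c))); apply: eq_big => v //.
by rewrite !inE odd_flip eqbF_neg negbK eqb_id.
Qed.

End parity_classes.

(** A constant summand shows that the classes have equal size, and together they partition the
    [2 ^ n.+1] subsets. *)
Lemma card_parity_class n b : #|parity_class n.+1 b| = (2 ^ n)%N.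
Proof.
have h : #|parity_class n.+1 false| = #|parity_class n.+1 true|.
  by rewrite -!sum1_card; exact: (big_parity_class _ (c := ord0)).
have : (#|parity_class n.+1 false| + #|parity_class n.+1 true| = 2 ^ n.+1)%N.
  rewrite (_ : parity_class n.+1 true = ~: parity_class n.+1 false).
    by rewrite cardsC -[in LHS]cardsT -powersetT card_powerset cardsT card_ord.
  by apply/setP => v; rewrite !inE; case: odd.
by case: b; rewrite -h expnS mul2n addnn => /double_inj.
Qed.

(** * Vertices of the cube and the parameter distance *)

Section cube.
Context {R : realType} (d : nat).

Definition cube_vertex (v : {set 'I_d}) : d.-tuple R :=
  [tuple (i \in v)%:R | i < d].

Lemma dist2_cube_vertex (u v : {set 'I_d}) :
  u != v -> 1 <= dist2 (cube_vertex u) (cube_vertex v).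
Proof.
move=> uv; have [i iuv] : exists i, (i \in u) != (i \in v).
  apply/existsP; rewrite -negb_forall; apply: contra uv => /forallP h.
  by apply/eqP/setP => i; apply/eqP.
rewrite /dist2 /norm2 -[leLHS]sqrtr1 ler_sqrt; last first.
  by apply: sumr_ge0 => j _; exact: sqr_ge0.
rewrite (bigD1 i)//= !tnth_mktuple; apply: (@le_trans _ _ (((i \in u)%:R - (i \in v)%:R) ^+ 2)).
  by move: iuv; case: (i \in u); case: (i \in v) => //= _; rewrite ?sub0r ?subr0 ?sqrrN expr1n.
by rewrite lerDl; apply: sumr_ge0 => j _; exact: sqr_ge0.
Qed.

Lemma shift_cube_vertex_flip c (v : {set 'I_d}) (x : d.-tuple R) i : i != c ->
  tnth (shiftv (cube_vertex (flip c v)) x) i = tnth (shiftv (cube_vertex v) x) i.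
Proof. by move=> ic; rewrite !tnth_mktuple in_flip. Qed.

(* Out of range, [nth] returns its default: the empty set, i.e. the origin. *)
Definition padded_class (b : bool) (k : nat) (j : 'I_k) : d.-tuple R :=
  cube_vertex (nth finset.set0 (enum (parity_class d b)) j).

End cube.

Lemma param_dist_ge {R : realType} k d (mu nu : 'I_k -> d.-tuple R) (B : R) :
  (forall s, B <= match_cost mu nu s) -> B <= param_dist mu nu.
Proof.
move=> h; rewrite /param_dist; elim/big_ind : _ => // x y Bx By.
by rewrite le_min Bx.
Qed.

(* A nonzero even vertex is never matched at cost zero, and the padding puts only
   the zero vertex among the odd ones. *)
Lemma param_dist_padded_class {R : realType} n k : (2 ^ n <= k)%N ->
  (2 ^ n).-1%:R <= param_dist (@padded_class R n.+1 false k)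
                             (@padded_class R n.+1 true k).
Proof.
move=> nk; apply: param_dist_ge => s.
pose E := enum (parity_class n.+1 false); pose O := enum (parity_class n.+1 true).
(* Every index with a nonzero even center costs at least 1, so the cost is at least the number of
   such indices. *)
apply: (@le_trans _ _ (\sum_(j < k) (nth finset.set0 E j != finset.set0)%:R)); last first.
  apply: ler_sum => j _; have [|E0] := eqVneq; first by rewrite sqrtr_ge0.
  apply: dist2_cube_vertex.
  (* An index past the odd list is matched to the origin, which differs from a nonzero vertex. *)
  have [Oj|Oj] := ltnP (s j) (size O); last by rewrite (nth_default _ Oj).
  have Ej : (j < size E)%N.
    by rewrite ltnNge; apply: contra E0 => Ej; rewrite nth_default.
  have : nth finset.set0 O (s j) \in parity_class n.+1 true by rewrite -mem_enum mem_nth.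
  have : nth finset.set0 E j \in parity_class n.+1 false by rewrite -mem_enum mem_nth.
  rewrite !inE => /eqP evenE /eqP oddO.
  by apply/eqP => EO; move: oddO; rewrite -EO evenE.
rewrite (big_ord_nth_default _ _ (fun v => (v != finset.set0)%:R)); last first.
  by rewrite -cardE card_parity_class.
(* The padding counts 0, and the empty set is the one even set to discard among [2 ^ n]. *)
rewrite eqxx /= big1_eq addr0 big_enum/=.
rewrite (bigD1 finset.set0)/=; last by rewrite inE cards0.
rewrite eqxx add0r (eq_bigr (fun=> 1)); last by move=> v /andP[_ ->].
rewrite sumr_const ler_nat -(card_parity_class n false) (cardsD1 finset.set0).
rewrite inE cards0 /=; apply: eq_leq; apply: eq_card => v.
by rewrite !inE unfold_in inE andbC.
Qed.

(** The [r] indices take at most [r] values. *)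
Lemma exists_missed_coordinate r d (i : {ffun 'I_r -> 'I_d}) :
  (r < d)%N -> exists c, forall s, i s != c.
Proof.
move=> rd; have : (0 < #|~: [set i s | s : 'I_r]|)%N.
  rewrite -(ltn_add2l #|[set i s | s : 'I_r]|) addn0 cardsC card_ord.
  by apply: leq_ltn_trans (leq_imset_card _ _) _; rewrite card_ord.
case/card_gt0P => c; rewrite inE => ci; exists c => s.
by apply: contraNneq ci => <-; exact: imset_f.
Qed.

(** * Agreement of the mixtures on functions that ignore one coordinate *)

Section matching_moments.
Context {R : realType} (n k : nat).
Hypothesis nk : (2 ^ n <= k.+1)%N.
Variables (L0 : probability (n.+1.-tuple R) R).
Variables (L : n.+1.-tuple R -> probability (n.+1.-tuple R) R).
Hypothesis LE : forall m (f : n.+1.-tuple R -> \bar R), measurable_fun setT f ->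
  (forall x, 0 <= f x)%E -> (\int[L m]_x f x = \int[L0]_x f (shiftv m x))%E.
Variable P : bool -> probability (n.+1.-tuple R) R.
Hypothesis PE : forall b (f : n.+1.-tuple R -> \bar R), measurable_fun setT f ->
  (forall x, 0 <= f x)%E -> (\int[P b]_x f x =
  (k.+1%:R^-1)%:E * \sum_(j < k.+1) \int[L (padded_class n.+1 b j)]_x f x)%E.

(** Both sums of centers have the same padding. After translation to [L0], the integral attached to
    a vertex [v] is invariant under [flip c], which exchanges the classes. *)
Lemma ge0_integral_padded_mixture c (h : n.+1.-tuple R -> \bar R) :
  measurable_fun setT h -> (forall x, 0 <= h x)%E ->
  (forall x y, (forall i, i != c -> tnth x i = tnth y i) -> h x = h y) ->
  (\int[P false]_x h x = \int[P true]_x h x)%E.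
Proof.
move=> mh h0 hc; rewrite !PE//; congr (_ * _)%E.
pose F (v : {set 'I_n.+1}) := (\int[L (cube_vertex v)]_x h x)%E.
rewrite (big_ord_nth_default _ _ F); last by rewrite -cardE card_parity_class.
rewrite [RHS](big_ord_nth_default _ _ F); last by rewrite -cardE card_parity_class.
rewrite -!cardE !card_parity_class !big_enum/=; congr (_ + _)%E.
apply: (big_parity_class _ (c := c)) => v.
rewrite /F !LE//; apply: eq_integral => x _; apply: hc => i ic.
exact: shift_cube_vertex_flip.
Qed.

(** The positive and negative parts of [h] also ignore the coordinate [c]. *)
Lemma integral_padded_mixture c (h : n.+1.-tuple R -> R) :
  measurable_fun setT h ->
  (forall x y, (forall i, i != c -> tnth x i = tnth y i) -> h x = h y) ->
  (\int[P false]_x (h x)%:E = \int[P true]_x (h x)%:E)%E.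
Proof.
move=> mh hc; have mhE : measurable_fun setT (EFin \o h) by exact/measurable_EFinP.
rewrite [LHS]integralE [RHS]integralE; congr (_ - _)%E.
- apply: (ge0_integral_padded_mixture (c := c)) => //.
    exact: measurable_funepos.
  by move=> x y /hc hxy; rewrite !funeposE/= hxy.
- apply: (ge0_integral_padded_mixture (c := c)) => //.
    exact: measurable_funeneg.
  by move=> x y /hc hxy; rewrite !funenegE/= hxy.
Qed.

Lemma integrable_padded_mixture b (h : n.+1.-tuple R -> R) :
  (forall m, all_moments (L m) h) ->
  (P b).-integrable setT (fun x => (h x)%:E).
Proof.
move=> hL; have [mh _] := hL (nseq_tuple _ 0).
apply/integrableP; split; first exact/measurable_EFinP.
rewrite PE//; last by apply/measurable_EFinP; exact: measurableT_comp.
apply: lte_mul_pinfty => //; apply: lte_sum_pinfty => j _.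
by have /integrableP[] := all_moments_integrable (hL (padded_class n.+1 b j)).
Qed.

End matching_moments.

(** * Comparison of the truncated base-2 logarithm with [ln] *)

Section logarithm_bounds.
Context {R : realType}.

Lemma ln2_gt0 : 0 < ln 2 :> R. Proof. by rewrite ln_gt0// ltr1n. Qed.

Lemma ln2_le1 : ln 2 <= 1 :> R.
Proof. by have := @le_ln1Dx R 1; apply; rewrite (lt_trans (ltrN10 R)). Qed.

Lemma trunc_log_ln k : (0 < k)%N ->
  (trunc_log 2 k)%:R * ln 2 <= ln (k%:R : R) <= (trunc_log 2 k).+1%:R * ln 2.
Proof.
move=> k0; have /andP[lo hi] := trunc_log_bounds (isT : (1 < 2)%N) k0.
rewrite !mulr_natl -!lnXn ?ltr0n// -!natrX !ler_ln ?posrE ?ltr0n ?expn_gt0//.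
by rewrite !ler_nat lo ltnW.
Qed.

End logarithm_bounds.

Theorem theorem3p14 (R : realType) :
  exists (a1 a2 b1 b2 c c' : R) (k0 : nat),
    [/\ 0 < a1, 0 < a2, 0 < b1 & 0 < b2] /\ 0 < c /\ 0 < c' /\
    forall k : nat, (k0 <= k)%N ->
    exists d D : nat,
      a1 * ln k%:R <= d%:R <= a2 * ln k%:R /\
      b1 * ln k%:R <= D%:R <= b2 * ln k%:R /\
      exists (mu nu : 'I_k -> d.-tuple R) (P Q : probability (d.-tuple R) R),
        is_unif_Lap_mixture P mu /\ is_unif_Lap_mixture Q nu /\
        (forall r : nat, (1 <= r <= D)%N ->
           has_moment r P /\ has_moment r Q /\
           normF [ffun i => moment r P i - moment r Q i]
             <= k%:R `^ (- (c * ln (ln k%:R)))) /\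
        c' * Num.sqrt (ln k%:R) <= param_dist mu nu.
Proof.
have l0 := @ln2_gt0 R; have l1 := @ln2_le1 R.
(* With [n ln 2 <= ln k <= (n + 1) ln 2] and [n >= 1], guaranteed by [k >= 2], the bounds on
   [d = n + 1] and [D = n] follow from [n + 1 <= 2 n]. *)
exists (ln 2)^-1, (2 / ln 2), (2 * ln 2)^-1, (ln 2)^-1, 1, 2^-1, 2%N.
split; first by split; rewrite ?divr_gt0 ?invr_gt0 ?mulr_gt0.
split=> //; split; first by rewrite invr_gt0.
case=> [//|k] k2; set n := trunc_log 2 k.+1.
have /andP[lo hi] := @trunc_log_ln R k.+1 isT; rewrite -/n in lo hi.
have n1 : (1 <= n)%N by rewrite trunc_log_max.
have n1R : 1 <= n%:R :> R by rewrite ler1n.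
have nk : (2 ^ n <= k.+1)%N by rewrite trunc_logP.
set l := ln k.+1%:R in lo hi *.
exists n.+1, n; split; [|split].
- rewrite mulrC ler_pdivrMr// hi/= mulrAC ler_pdivlMr// -natr1.
  nra.
- rewrite mulrC ler_pdivrMr ?mulr_gt0// [_^-1 * _]mulrC ler_pdivlMr// lo andbT.
  by move: hi; rewrite -natr1; nra.
have [L0 [L LP]] := @exists_Lap R n.+1.
(* Choosing the mixtures as a function of the parity [b] treats both at once. *)
have mix b := cid (exists_unif_mixture
  (fun j : 'I_k.+1 => L (padded_class n.+1 b j))).
pose P b := sval (mix b); have PP b := svalP (mix b).
have LE m := let: And3 _ _ h := LP m in h.
have PE b := proj2 (PP b).
exists (@padded_class R n.+1 false k.+1), (@padded_class R n.+1 true k.+1).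
exists (P false), (P true).
have mixP b : is_unif_Lap_mixture (P b) (@padded_class R n.+1 b k.+1).
  exists (fun j => L (padded_class n.+1 b j)); split=> [j|A _]; last exact: (proj1 (PP b)).
  by have [] := LP (padded_class n.+1 b j).
split=> //; split=> //; split.
- move=> r /andP[_ rn].
  have mom i m : all_moments (L m) (fun x => tensor_pow r x i).
    under eq_fun do rewrite ffunE.
    by apply: all_moments_prod => s; have [_ + _] := LP m; apply.
  have hm b : has_moment r (P b).
    by move=> i; exact: (integrable_padded_mixture (P := P) PE b (mom i)).
  split=> //; split=> //.
  (* The moment tensors coincide, so the bound reduces to nonnegativity of the power. *)
  rewrite (_ : normF _ = 0) ?powR_ge0// /normF big1 ?sqrtr0// => i _.
  rewrite !ffunE !expectation.unlock.
  have [c ic] : exists c, forall s, i s != c.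
    by apply: exists_missed_coordinate; rewrite ltnS.
  rewrite (integral_padded_mixture nk LE PE (c := c)) ?subrr ?expr0n//.
    by have [] := mom i (nseq_tuple _ 0).
  by move=> x y xy; rewrite !ffunE; apply: eq_bigr => s _; exact: xy.
- apply: le_trans (param_dist_padded_class nk).
  have l_ge0 : 0 <= l by rewrite ln_ge0// ler1n.
  have h : n%:R <= (2 ^ n).-1%:R :> R.
    (* This is [n < 2 ^ n]. *)
    by rewrite ler_nat -ltnS prednK ?expn_gt0// ltn_expl.
  apply: le_trans h.
  (* [sqrt l <= (l + 1) / 2] and [l <= n + 1] give [sqrt l / 2 <= (n + 2) / 4 <= n]. *)
  have := sqr_sqrtr l_ge0; have := sqr_ge0 (Num.sqrt l - 1).
  move: hi; rewrite -natr1; nra.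
Qed.
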